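(* Let $h^*$ be the unique real polynomial of degree at most $1$ minimizing $\max_{t\in[0,1]}|h(t)-\sqrt{1+t^2}|$ among all real polynomials $h$ of degree at most $1$, and let $t_1\in(0,1)$ be the interior critical (alternation) point of the error $h^*(t)-\sqrt{1+t^2}$. Then $$t_1=\sqrt{\frac{\sqrt2-1}{2}},$$ and $t_1$ is a root of $4x^4+4x^2-1$, which is irreducible over $\mathbb{Q}$ and whose Galois group over $\mathbb{Q}$ is $D_4$, the dihedral group of order $8$. In particular, $t_1$ is expressible by radicals.
   Context: The optimal error $h^*(t)-\sqrt{1+t^2}$ attains its maximum absolute value on $[0,1]$ with alternating signs at exactly three points, namely $0$, an interior point $t_1$, and $1$; $t_1$ is the interior alternation point, at which the derivative of the error vanishes. *)

(* Defs.v *)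
From HB Require Import structures.
From mathcomp Require Import all_boot all_order all_algebra.
From mathcomp Require Import all_fingroup all_solvable all_field.
From mathcomp Require Import complex.
From mathcomp Require Import all_classical all_reals all_analysis.

Set Implicit Arguments.
Unset Strict Implicit.
Unset Printing Implicit Defensive.

Import Order.TTheory GRing.Theory Num.Theory.
Import numFieldNormedType.Exports.

Local Open Scope classical_set_scope.
Local Open Scope ring_scope.

Definition approx_error (R : realType) (h : {poly R}) (t : R) : R :=
  h.[t] - Num.sqrt (1 + t ^+ 2).

(* The supremum is a maximum, the error being continuous on [0, 1]. *)
Definition max_error (R : realType) (h : {poly R}) : R :=
  sup [set `|approx_error h t| | t in `[0, 1]].

(* [size h <= 2] is [deg h <= 1]. *)
Definition best_linear_approx (R : realType) (h : {poly R}) : Prop :=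
  (size h <= 2)%N /\
  forall g : {poly R}, (size g <= 2)%N -> max_error h <= max_error g.

Definition interior_critical_point (R : realType) (h : {poly R}) (t : R) :
    Prop :=
  0 < t < 1 /\ is_derive t (1 : R) (approx_error h) 0.

Definition interior_alternation_point (R : realType) (h : {poly R}) (t1 : R) :
    Prop :=
  [/\ forall t : R, 0 <= t <= 1 ->
        (`|approx_error h t| = max_error h <-> [\/ t = 0, t = t1 | t = 1]),
      approx_error h 0 * approx_error h t1 < 0
    & approx_error h t1 * approx_error h 1 < 0].

(* Splitting fields exist and are unique up to isomorphism; the group of a    *)
(* polynomial is the Galois group of any of them.  The first conjunct keeps   *)
(* the second one from being vacuous.                                         *)
Definition galois_group_isog (p : {poly rat}) (gT : finGroupType)
    (G : {group gT}) : Prop :=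
  (exists L : splittingFieldType rat,
     splittingFieldFor 1%AS (map_poly (in_alg L) p) {:L}) /\
  (forall L : splittingFieldType rat,
     splittingFieldFor 1%AS (map_poly (in_alg L) p) {:L} ->
     'Gal({:L} / 1%AS)%g \isog G).

(* The smallest subset of [K] that contains the rationals and is closed under *)
(* the field operations and under extraction of arbitrary n-th roots in [K].  *)
Inductive expressible_by_radicals (K : numFieldType) : K -> Prop :=
| Radical_rat (q : rat) : expressible_by_radicals (ratr q)
| Radical_add (x y : K) : expressible_by_radicals x ->
    expressible_by_radicals y -> expressible_by_radicals (x + y)
| Radical_opp (x : K) : expressible_by_radicals x ->
    expressible_by_radicals (- x)
| Radical_mul (x y : K) : expressible_by_radicals x ->
    expressible_by_radicals y -> expressible_by_radicals (x * y)
| Radical_inv (x : K) : expressible_by_radicals x ->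
    expressible_by_radicals x^-1
| Radical_root (n : nat) (x : K) : (0 < n)%N ->
    expressible_by_radicals (x ^+ n) -> expressible_by_radicals x.

Definition quartic : {poly rat} := 4 *: 'X^4 + 4 *: 'X^2 - 1.

(* Main.v *)
(* The graph of [f t = sqrt (1 + t ^+ 2)] lies below its chord over [0, 1] and
   above the tangent parallel to it.  The line halfway between the two has an
   error that equioscillates at 0, at the point of tangency and at 1, which
   makes it the unique best approximation; its slope is m = sqrt 2 - 1, and
   m ^ 2 + 2 m = 1 puts the point of tangency at sqrt (m / 2).
   For the Galois group, let a be a root of the quartic and b a root of
   X ^ 2 + 1 + a ^ 2.  Then (2 a b) ^ 2 = -1, while Q(a) is isomorphic to the
   real field Q(sqrt (m / 2)), so b lies outside Q(a) and the splitting field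
   Q(a, b) has degree 8.  Its automorphisms a -> b -> -a and a -> a, b -> -b
   satisfy the relations of the dihedral group. *)
Require Import Defs.
From HB Require Import structures.
From mathcomp Require Import all_boot all_order all_algebra.
From mathcomp Require Import all_fingroup all_solvable all_field.
From mathcomp Require Import complex.
From mathcomp Require Import all_classical all_reals all_analysis.
From mathcomp Require Import ring lra.
Import Order.TTheory GRing.Theory Num.Theory.
Import numFieldNormedType.Exports.
Local Open Scope classical_set_scope.
Local Open Scope ring_scope.

(** * The best linear approximation *)

Lemma horner_linear (K : nzRingType) (p : {poly K}) (x : K) :
  (size p <= 2)%N -> p.[x] = p`_0 + p`_1 * x.
Proof.
move=> sp; rewrite (horner_coef_wide _ sp).
by rewrite !big_ord_recr big_ord0 /= add0r expr0 mulr1 expr1.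
Qed.

Lemma approx_error_le_max (R : realType) (h : {poly R}) (t : R) :
  (size h <= 2)%N -> 0 <= t <= 1 -> `|approx_error h t| <= max_error h.
Proof.
move=> sh t01; apply: ub_le_sup; last by exists t; rewrite //= in_itv.
(* [sup] is an upper bound only of a bounded set, so a crude explicit bound is supplied; the 2
   dominates the square root on [0, 1]. *)
exists (`|h`_0| + `|h`_1| + 2) => _ [s /= + <-]; rewrite in_itv /= => /andP[s0 s1].
rewrite /approx_error horner_linear // (le_trans (ler_normB _ _)) // lerD //.
  rewrite (le_trans (ler_normD _ _)) // lerD2l normrM (ger0_norm s0).
  by rewrite ler_piMr.
rewrite ger0_norm ?sqrtr_ge0 // -[leRHS]ger0_norm // -sqrtr_sqr ler_wsqrtr //.
by nra.
Qed.

Lemma max_error_le (R : realType) (h : {poly R}) (E : R) :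
  (forall t, 0 <= t <= 1 -> `|approx_error h t| <= E) -> max_error h <= E.
Proof.
move=> hE; apply: ge_sup.
  by exists `|approx_error h 0|, 0; rewrite //= in_itv /= lexx ler01.
by move=> _ [s /= + <-]; rewrite in_itv /= => /hE.
Qed.

Definition chord_slope {R : realType} : R := Num.sqrt 2 - 1.

Definition tangency_point {R : realType} : R := Num.sqrt (chord_slope / 2).

(* The line halfway between the chord and the tangent parallel to it. *)
Definition best_line {R : realType} : {poly R} :=
  ((1 + Num.sqrt (2 * chord_slope)) / 2)%:P + chord_slope *: 'X.

(** Half the vertical gap between the chord 1 + m t and the tangent r + m t, where m is the chord
    slope and r = sqrt (2 m). *)
Definition best_error {R : realType} : R := (1 - Num.sqrt (2 * chord_slope)) / 2.

Section Real.
Variable R : realType.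
Local Notation m := (@chord_slope R).
Local Notation r := (Num.sqrt (2 * m)).
Local Notation t1 := (@tangency_point R).
Local Notation h := (@best_line R).
Local Notation E := (@best_error R).

Lemma chord_slope_sqr : m ^+ 2 = 1 - 2 * m.
Proof.
have s2 : Num.sqrt 2 ^+ 2 = 2 :> R by rewrite sqr_sqrtr.
by rewrite /chord_slope; lra.
Qed.

(** The upper bound yields [r < 1] and [t1 < 1]: the error [E] is positive and the tangency point is
    interior. *)
Lemma chord_slope_bounds : 0 < m < 2^-1.
Proof.
have s2 : Num.sqrt 2 ^+ 2 = 2 :> R by rewrite sqr_sqrtr.
have s0 : 0 <= Num.sqrt 2 :> R by exact: sqrtr_ge0.
by rewrite /chord_slope; apply/andP; split; nra.
Qed.

Let m0 : 0 < m. Proof. by case/andP: chord_slope_bounds. Qed.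
Let m1 : m < 2^-1. Proof. by case/andP: chord_slope_bounds. Qed.
Let mm := chord_slope_sqr.
Let r2 : r ^+ 2 = 2 * m. Proof. by rewrite sqr_sqrtr // mulr_ge0 // ltW. Qed.
Let r0 : 0 < r. Proof. by rewrite sqrtr_gt0 mulr_gt0. Qed.
Let r1 : r < 1. Proof. by move: (r) r2 r0 m1 => s ? ? ?; nra. Qed.

Lemma tangency_point_sqr : t1 ^+ 2 = m / 2.
Proof. by rewrite sqr_sqrtr // divr_ge0 // ltW. Qed.

Let t2 := tangency_point_sqr.
Let t0 : 0 < t1. Proof. by rewrite sqrtr_gt0 divr_gt0. Qed.
Let t11 : t1 < 1. Proof. by move: t1 t2 t0 m1 => s ? ? ?; nra. Qed.
Let rt : r * t1 = m.
Proof.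
apply/eqP; rewrite -(@eqrXn2 _ 2) // ?mulr_ge0 ?ltW // exprMn r2 t2.
by apply/eqP; field.
Qed.

Lemma size_best_line : (size h <= 2)%N.
Proof.
rewrite (leq_trans (size_polyD _ _)) // geq_max.
rewrite (leq_trans (size_polyC_leq1 _)) //.
by rewrite (leq_trans (size_scale_leq _ _)) ?size_polyX.
Qed.

Lemma best_line_errorE (t : R) :
  approx_error h t = (1 + r) / 2 + m * t - Num.sqrt (1 + t ^+ 2).
Proof. by rewrite /approx_error /best_line hornerD hornerC hornerZ hornerX. Qed.

Lemma best_error_gt0 : 0 < E.
Proof. by rewrite /best_error divr_gt0 // subr_gt0. Qed.

(** Cauchy-Schwarz for (m, r) and (t, 1): since m^2 + r^2 = 1, the defect 1 + t^2 - (m t + r)^2 is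
    the square of r t - m = r (t - t1). *)
Lemma sqrt_ge_tangent (t : R) : 0 <= t ->
  m * t + r <= Num.sqrt (1 + t ^+ 2) ?= iff (t == t1).
Proof.
move=> t_ge0.
have e : 1 + t ^+ 2 = (m * t + r) ^+ 2 + (r * t - m) ^+ 2.
  have -> : (m * t + r) ^+ 2 + (r * t - m) ^+ 2 =
    (m ^+ 2 + r ^+ 2) * (1 + t ^+ 2) by ring.
  by rewrite mm r2; ring.
have p : 0 <= m * t + r by rewrite addr_ge0 ?mulr_ge0 // ltW.
split.
  by rewrite -[leLHS]ger0_norm // -sqrtr_sqr ler_wsqrtr // e lerDl sqr_ge0.
apply/eqP/eqP => [q|te].
  have : (r * t - m) ^+ 2 = 0.
    have := congr1 (fun z => z ^+ 2) q; rewrite sqr_sqrtr ?addr_ge0 ?sqr_ge0 // e.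
    by move=> q'; lra.
  move/eqP; rewrite sqrf_eq0 -[X in _ - X]rt -mulrBr mulf_eq0 gt_eqF //= subr_eq0.
  by move/eqP.
rewrite -[LHS]ger0_norm // -sqrtr_sqr; congr Num.sqrt.
rewrite e te rt subrr; ring.
Qed.

(** By m^2 = 1 - 2 m, the squares of the two sides differ by 2 m t (1 - t). *)
Lemma sqrt_le_chord (t : R) : 0 <= t <= 1 ->
  Num.sqrt (1 + t ^+ 2) <= 1 + m * t ?= iff (t == 0) || (t == 1).
Proof.
move=> /andP[t_ge0 t_le1].
have e : (1 + m * t) ^+ 2 = 1 + t ^+ 2 + 2 * m * (t * (1 - t)).
  have -> : (1 + m * t) ^+ 2 = 1 + 2 * m * t + m ^+ 2 * t ^+ 2 by ring.
  by rewrite mm; ring.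
have p : 0 <= 1 + m * t by rewrite addr_ge0 ?mulr_ge0 // ltW.
split.
  rewrite -[leRHS]ger0_norm // -sqrtr_sqr ler_wsqrtr // e lerDl.
  by apply: mulr_ge0; apply: mulr_ge0; rewrite ?(ltW m0) ?subr_ge0.
rewrite -(@eqrXn2 _ 2) ?sqrtr_ge0 // sqr_sqrtr ?addr_ge0 ?sqr_ge0 // e.
rewrite eq_sym addrC -subr_eq0 addrK !mulf_eq0 pnatr_eq0 (gt_eqF m0) /=.
by rewrite subr_eq0 [1 == t]eq_sym.
Qed.

(** The chord bounds the error below by -E, the tangent bounds it above by E. *)
Lemma best_line_error_le (t : R) : 0 <= t <= 1 -> `|approx_error h t| <= E.
Proof.
move=> t01; have [c _] := sqrt_le_chord _ t01.
have [d _] : m * t + r <= Num.sqrt (1 + t ^+ 2) ?= iff (t == t1).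
  by apply: sqrt_ge_tangent; case/andP: t01.
by rewrite best_line_errorE /best_error ler_norml; apply/andP; split; lra.
Qed.

Lemma best_line_error0 : approx_error h 0 = - E.
Proof.
rewrite best_line_errorE expr0n addr0 sqrtr1 mulr0 /best_error; lra.
Qed.

Lemma best_line_error1 : approx_error h 1 = - E.
Proof.
rewrite best_line_errorE expr1n mulr1 /best_error /chord_slope; lra.
Qed.

Lemma best_line_error_tangency : approx_error h t1 = E.
Proof.
have [_ /esym] := sqrt_ge_tangent _ (ltW t0); rewrite eqxx => /esym/eqP e.
by rewrite best_line_errorE -e /best_error; lra.
Qed.

Lemma max_error_best_line : max_error h = E.
Proof.
apply/eqP; rewrite eq_le; apply/andP; split.
  exact: max_error_le best_line_error_le.
have := approx_error_le_max _ h 0 size_best_line.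
by rewrite lexx ler01 best_line_error0 normrN gtr0_norm ?best_error_gt0 //; apply.
Qed.

(* The three alternation points make a line at least as good as [h] lie above
   [h] at 0 and at 1 but below [h] at the tangency point in between. *)
Lemma best_line_unique (g : {poly R}) :
  (size g <= 2)%N -> max_error g <= max_error h -> g = h.
Proof.
move=> sg; rewrite max_error_best_line => gE.
have gle t : 0 <= t <= 1 -> `|approx_error g t| <= E.
  by move=> t01; rewrite (le_trans (approx_error_le_max _ _ _ sg t01)).
have g0 : g.[0] >= h.[0].
  have := gle 0; rewrite lexx ler01 => /(_ isT); rewrite ler_norml => /andP[+ _].
  by rewrite -best_line_error0 /approx_error lerD2r.
have g1 : g.[1] >= h.[1].
  have := gle 1; rewrite lexx ler01 => /(_ isT); rewrite ler_norml => /andP[+ _].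
  by rewrite -best_line_error1 /approx_error lerD2r.
have gt : g.[t1] <= h.[t1].
  have := gle t1; rewrite (ltW t0) (ltW t11) => /(_ isT); rewrite ler_norml => /andP[_].
  by rewrite -best_line_error_tangency /approx_error lerD2r.
move: g0 g1 gt; rewrite !horner_linear ?size_best_line // !mulr0 !mulr1 !addr0.
move=> g0 g1 gt.
have c0 : g`_0 = h`_0.
  by apply: le_anti; rewrite g0 andbT; move: t0 t11 => ? ?; nra.
have c1 : g`_1 = h`_1.
  by apply: le_anti; apply/andP; split; move: t0 t11; rewrite c0 in g1 gt * => ? ?; nra.
apply/polyP => -[|[|i]] //; rewrite !nth_default // ?(leq_trans sg) //.
by rewrite (leq_trans size_best_line).
Qed.

Lemma best_linear_approxP (g : {poly R}) : best_linear_approx g <-> g = h.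
Proof.
split=> [[sg gmin]|->].
  by apply: best_line_unique => //; apply: gmin; exact: size_best_line.
split=> [|g' sg']; first exact: size_best_line.
(* Optimality follows from uniqueness: a strictly better line would be [h] itself. *)
rewrite leNgt; apply/negP => lt; have := lt.
by rewrite (best_line_unique _ sg' (ltW lt)) ltxx.
Qed.

(** * Critical point and alternation of the error *)

Lemma approx_error_derive (g : {poly R}) (t : R) :
  is_derive t (1 : R) (approx_error g) (g^`().[t] - t / Num.sqrt (1 + t ^+ 2)).
Proof.
have p : 0 < 1 + t ^+ 2 by rewrite ltr_pwDl ?sqr_ge0.
have sq := is_derive1_sqrt p.
(* The radicand as a polynomial, so that the chain rule can use the formal derivative. *)
pose q : {poly R} := 1 + 'X^2.
have qE : q.[t] = 1 + t ^+ 2 by rewrite hornerD hornerC hornerXn.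
rewrite -qE in sq.
have c := is_derive1_comp sq (is_derive_poly q t).
have -> : approx_error g = horner g - (Num.sqrt \o horner q).
  by apply/funext => s; rewrite /approx_error !fctE /= hornerD hornerC hornerXn.
apply: (trigger_derive (is_deriveB (is_derive_poly g t) c)).
rewrite derivD derivC add0r derivXn hornerMn hornerXn qE; field.
by rewrite gt_eqF // sqrtr_gt0.
Qed.

Lemma best_line_critical (t : R) : interior_critical_point h t <-> t = t1.
Proof.
have s0 (s : R) : 0 < Num.sqrt (1 + s ^+ 2).
  by rewrite sqrtr_gt0 ltr_pwDl ?sqr_ge0.
have dh s : h^`().[s] = m.
  by rewrite /best_line derivD derivC derivZ derivX add0r hornerZ hornerC mulr1.
split=> [[/andP[tg0 tl1]] [_ d]|->].
  have [_] := approx_error_derive h t; rewrite d dh => /esym/eqP.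
  rewrite subr_eq0 => /eqP e.
  apply/eqP; rewrite -(@eqrXn2 _ 2) ?(ltW t0) ?(ltW tg0) // t2.
  have : t = m * Num.sqrt (1 + t ^+ 2) by rewrite e divfK ?gt_eqF.
  (* Squaring m sqrt (1 + t^2) = t and using m^2 = 1 - 2 m leaves 2 m t^2 = m^2. *)
  move/(congr1 (fun z => z ^+ 2)); rewrite exprMn sqr_sqrtr ?addr_ge0 ?sqr_ge0 // mm.
  move=> tE; have : 2 * m * (t ^+ 2 - m / 2) = 0.
    have -> : 2 * m * (t ^+ 2 - m / 2) = 2 * m * t ^+ 2 - m ^+ 2 by field.
    by rewrite mm; move: tE; lra.
  by move/eqP; rewrite !mulf_eq0 pnatr_eq0 (gt_eqF m0) /= subr_eq0.
split; first by rewrite t0.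
rewrite -[0](_ : h^`().[t1] - t1 / Num.sqrt (1 + t1 ^+ 2) = 0).
  exact: approx_error_derive.
(* The equality case of the tangent bound replaces the square root at [t1] by m t1 + r. *)
have [_ /esym] := sqrt_ge_tangent _ (ltW t0); rewrite eqxx => /esym/eqP e.
have n0 : m * t1 + r != 0 by rewrite e gt_eqF.
rewrite dh -e; apply: (mulIf n0); rewrite mulrBl divfK // mul0r mulrDr mulrA -expr2.
by rewrite mm -[X in X * r]rt mulrAC -expr2 r2; ring.
Qed.

Lemma best_line_alternation : interior_alternation_point h t1.
Proof.
have E0 := best_error_gt0.
split; first 1 last.
- by rewrite best_line_error0 best_line_error_tangency mulNr oppr_lt0 mulr_gt0.
- by rewrite best_line_error1 best_line_error_tangency mulrN oppr_lt0 mulr_gt0.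
move=> t t01; rewrite max_error_best_line; split; last first.
  case=> ->; rewrite ?best_line_error0 ?best_line_error1 ?normrN.
  - by rewrite gtr0_norm.
  - by rewrite best_line_error_tangency gtr0_norm.
  - by rewrite gtr0_norm.
have [c ceq] := sqrt_le_chord _ t01.
have [d deq] : m * t + r <= Num.sqrt (1 + t ^+ 2) ?= iff (t == t1).
  by apply: sqrt_ge_tangent; case/andP: t01.
(* An extremal error that is nonnegative forces contact with the tangent, a negative one contact
   with the chord. *)
have [e|e] := lerP 0 (approx_error h t).
  rewrite (ger0_norm e) best_line_errorE /best_error => eE.
  by apply: Or32; apply/eqP; rewrite -deq; apply/eqP; lra.
rewrite (ltr0_norm e) best_line_errorE /best_error => eE.
have : (t == 0) || (t == 1) by rewrite -ceq; apply/eqP; lra.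
by case/orP => /eqP ->; [apply: Or31 | apply: Or33].
Qed.

End Real.

(** * Irreducibility of the quartic *)

(** The 2-adic valuation is even on the square of the numerator and odd on twice the square of the
    denominator. *)
Lemma rat_sqr_neq2 (q : rat) : q ^+ 2 != 2.
Proof.
apply/eqP => q2.
have : numq q ^+ 2 = 2 * denq q ^+ 2.
  apply: (@intr_inj rat); rewrite !rmorphXn rmorphM rmorphXn /=.
  by rewrite -[2%:~R]q2 -exprMn -numqE.
move/(congr1 absz); rewrite abszM !abszX /= => e.
have d0 : (0 < `|denq q|)%N by rewrite absz_gt0 denq_neq0.
have := congr1 (fun n => odd (logn 2 n)) e.
by rewrite lognM ?expn_gt0 ?d0 // !lognX oddD !oddM.
Qed.

Lemma size_quartic : size quartic = 5.
Proof.
rewrite /quartic -addrA size_polyDl size_scale ?size_polyXn //.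
rewrite (leq_ltn_trans (size_polyD _ _)) // size_scale // size_polyXn.
by rewrite size_polyN size_poly1.
Qed.

Lemma horner_quartic (K : fieldType) (f : {rmorphism rat -> K}) (x : K) :
  (map_poly f quartic).[x] = 4 * x ^+ 4 + 4 * x ^+ 2 - 1.
Proof.
rewrite /quartic rmorphB rmorphD /= !map_polyZ rmorph1 !map_polyXn /=.
by rewrite !hornerE !rmorph_nat.
Qed.

Lemma quartic_no_linear_factor (q : {poly rat}) :
  size q = 2%N -> ~~ (q %| quartic).
Proof.
move=> sq; apply/negP => dq.
have q1 : q`_1 != 0.
  by have := lead_coef_eq0 q; rewrite lead_coefE -size_poly_eq0 sq /= => ->.
have qx : root q (- q`_0 / q`_1).
  by rewrite /root horner_linear ?sq //; apply/eqP; field; rewrite q1.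
have /eqP := root_dvdp dq qx.
have -> : quartic = map_poly idfun quartic by rewrite map_poly_id.
rewrite horner_quartic; set x := _ / _ => e.
(* The quartic is (2 X^2 + 1)^2 - 2. *)
have /eqP[] := rat_sqr_neq2 (2 * x ^+ 2 + 1); lra.
Qed.

Lemma quartic_no_quadratic_factor (q : {poly rat}) :
  size q = 3%N -> ~~ (q %| quartic).
Proof.
move=> sq; apply/negP => /dvdpP[r e].
have sr : (size r <= 3)%N.
  have q0 : q != 0 by rewrite -size_poly_eq0 sq.
  have r0 : r != 0.
    by apply/eqP => r0; have := size_quartic; rewrite e r0 mul0r size_poly0.
  have := size_quartic; rewrite e size_mul // sq addnS /= addn2.
  by case=> ->.
have ck k : \sum_(j < k.+1) r`_j * q`_(k - j) = quartic`_k.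
  by rewrite e coefM.
have z (p : {poly rat}) k : (size p <= 3)%N -> (3 <= k)%N -> p`_k = 0.
  by move=> sp k3; rewrite nth_default // (leq_trans sp).
have q3 := z q _ (eq_leq sq); have r3 := z r _ sr.
have cq k : quartic`_k = 4 * (k == 4%N)%:R + 4 * (k == 2%N)%:R - (k == 0%N)%:R.
  by rewrite /quartic !coefE.
have := (ck 0%N, ck 1%N, ck 2%N, ck 3%N, ck 4%N).
rewrite !cq !big_ord_recr !big_ord0 /= ?subn0 ?subnn !subSS ?subn0.
rewrite (q3 3%N) // (q3 4%N) // (r3 3%N) // (r3 4%N) //.
move: (r`_0) (r`_1) (r`_2) (q`_0) (q`_1) (q`_2) => r0 r1 r2 q0 q1 q2.
case=> [[[[e0 e1] e2]] e3] e4.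
(* If the monic associate of [q] is [X^2 + a X + b], then [A = 4 a], [B = 4 b]
   and [C] is the constant term of the cofactor. *)
pose A := q1 * r2; pose B := q0 * r2; pose C := r0 * q2.
have BC : B * C = -4.
  have -> : B * C = (r0 * q0) * (r2 * q2) by rewrite /B /C; ring.
  have -> : r0 * q0 = -1 by lra.
  have -> : r2 * q2 = 4 by lra.
  by ring.
have q2r2 : r2 * q2 = 4 by lra.
have A1 : r1 * q2 = - A by rewrite /A; lra.
have S : 4 * (B + C) = 16 + A ^+ 2.
  have : (r0 * q2 + r1 * q1 + r2 * q0) * (r2 * q2) = 16 by rewrite q2r2; lra.
  have -> : (r0 * q2 + r1 * q1 + r2 * q0) * (r2 * q2) =
     C * (r2 * q2) + A * (r1 * q2) + B * (r2 * q2) by rewrite /A /B /C; ring.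
  rewrite q2r2 A1; lra.
have : A * (C - B) = 0.
  have -> : A * (C - B) = (r0 * q1 + r1 * q0) * (r2 * q2) - B * (A + r1 * q2).
    by rewrite /A /B /C; ring.
  rewrite A1; have -> : r0 * q1 + r1 * q0 = 0 by lra.
  by ring.
(* If A = 0, then B + C = 4 and B C = -4 give (B - 2)^2 = 8, so (B - 2) / 2 is a rational square
   root of 2. If B = C, then B^2 = -4. *)
move/eqP; rewrite mulf_eq0 => /orP[/eqP A0 | /eqP BeqC].
  have /eqP[] := rat_sqr_neq2 ((B - 2) / 2).
  rewrite A0 in S; have C4 : C = 4 - B by lra.
  rewrite C4 in BC; lra.
have BeC : C = B by lra.
by have := sqr_ge0 B; rewrite expr2 -{1}BeC mulrC BC.
Qed.

Lemma irreducible_quartic : irreducible_poly quartic.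
Proof.
have p0 : quartic != 0 by rewrite -size_poly_eq0 size_quartic.
split=> [|q sq1 dq]; first by rewrite size_quartic.
rewrite -(dvdp_size_eqp dq) size_quartic.
have q0 : q != 0 by apply: contraTneq dq => ->; rewrite dvd0p.
have := dvdp_leq p0 dq; rewrite size_quartic.
have [r e] := dvdpP _ _ dq.
have r0 : r != 0 by apply: contraNneq p0 => r0; rewrite e r0 mul0r.
have dr : r %| quartic by rewrite e dvdp_mulr.
have := size_quartic; rewrite {1}e size_mul //.
move: (quartic_no_linear_factor q) (quartic_no_linear_factor r).
move: (quartic_no_quadratic_factor q); rewrite dq dr.
have : size q != 0%N by rewrite size_poly_eq0.
(* The cases left are a linear factor, a quadratic factor and a cubic factor, whose cofactor is
   linear. *)
case: (size q) sq1 => [|[|[|[|[|[|n]]]]]] //=.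
- by move=> _ _ _ /(_ erefl).
- by move=> _ _ /(_ erefl).
- by rewrite addn4 /= => _ _ _ _ + [] => /[swap] ->  /(_ erefl).
Qed.

(** * The Galois group *)

(** The roots of [p] in [algC] generate a number field, and the factorization of [p] pulls back
    along its embedding. *)
Lemma splitting_field_exists (p : {poly rat}) : p != 0 ->
  exists L : splittingFieldType rat,
    splittingFieldFor 1%AS (map_poly (in_alg L) p) {:L}.
Proof.
move=> p0.
have [s es] := closed_field_poly_normal (map_poly (ratr : rat -> algC) p).
have [Q [QC [s1 es1 gen]]] := num_field_exists s.
have split : splittingFieldFor 1%AS (map_poly (in_alg Q) p) {:Q}.
  exists s1 => //; rewrite -(eqp_map QC) -map_poly_comp.
  have -> : map_poly (QC \o in_alg Q) p = map_poly (ratr : rat -> algC) p.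
    by apply: eq_map_poly => x /=; rewrite alg_num_field fmorph_rat.
  rewrite es rmorph_prod -es1 big_map /=.
  under [X in _ %= X]eq_bigr => i _ do rewrite map_polyXsubC.
  by rewrite eqp_scale // lead_coef_eq0 map_poly_eq0.
have ax : SplittingField.axiom Q.
  by exists (map_poly (in_alg Q) p) => //; apply/polyOver1P; exists p.
pose mix := FieldExt_isSplittingField.Build rat Q ax.
pose L : splittingFieldType rat := HB.pack (Q : fieldExtType rat) mix.
by exists L.
Qed.

(** The coefficients of [minPoly 1 a] come from [F], so its divisibility into [p] descends to [F],
    where irreducibility applies. *)
Lemma irreducible_minPoly (F : fieldType) (L : fieldExtType F) (p : {poly F})
    (a : L) : irreducible_poly p -> root (map_poly (in_alg L) p) a ->
  minPoly 1 a %= map_poly (in_alg L) p.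
Proof.
move=> [sp irr] pa.
have /polyOver1P[m em] := minPolyOver 1 a.
have : minPoly 1 a %| map_poly (in_alg L) p.
  by apply: minPoly_dvdp => //; apply/polyOver1P; exists p.
rewrite em dvdp_map eqp_map => /irr; apply.
have := size_minPoly 1 a; rewrite em size_map_poly => ->.
by rewrite eqSS; have := adim_gt0; rewrite -lt0n.
Qed.

(** The subgroup generated by [x] and [y] has order a multiple of [q] larger than [q], so it is all
    of [G]; the dihedral presentation and equality of orders conclude. *)
Lemma isog_dihedral (gT : finGroupType) (G : {group gT}) (x y : gT) (q : nat) :
    (1 < q)%N -> x \in G -> y \in G -> #|G| = q.*2 ->
    #[x]%g = q -> (y ^+ 2 = 1)%g -> (x ^ y = x^-1)%g -> y \notin <[x]>%g ->
  (G \isog [set: dihedral_gtype q.*2]%G)%g.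
Proof.
move=> q1 Gx Gy oG ox y2 xy nyx.
have sub : (<[x]> <*> <[y]> \subset G)%g by rewrite join_subG !cycle_subG Gx.
have cyc : (<[x]> \subset <[x]> <*> <[y]>)%g by rewrite joing_subl.
have GE : (<[x]> <*> <[y]> = G)%g.
  apply/eqP; rewrite eqEcard sub /= oG.
  have /dvdnP[k ek] := cardSg cyc; rewrite -orderE ox in ek.
  have : (q < #|(<[x]> <*> <[y]>)%g|)%N.
    rewrite -{1}ox orderE proper_card // properE cyc /=.
    by apply: contra nyx; rewrite join_subG => /andP[_]; rewrite cycle_subG.
  rewrite ek -mul2n leq_pmul2r ?(ltnW q1) //.
  by case: k {ek} => [|[|k]] //; rewrite ?mul0n ?mul1n ?ltnn ?ltn0.
apply/(isoGrpP _ (Grp_dihedral q1)); rewrite card_dihedral //; split=> //.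
apply/existsP; exists (x, y); rewrite /= !xpair_eqE /= -GE.
by rewrite -ox expg_order y2 xy !eqxx.
Qed.

(** Up to a constant, [q] is a subproduct of the linear factors, and the size condition makes it
    nonempty. *)
Lemma splits_root (K : fieldType) (p q : {poly K}) (rs : seq K) :
    p %= \prod_(x <- rs) ('X - x%:P) -> q %| p -> size q != 1 ->
  exists2 x, x \in rs & root q x.
Proof.
move=> eqp dq sq; have := dq; rewrite (eqp_dvdr _ eqp).
case/dvdp_prod_XsubC => m em.
case emm : (mask m rs) => [|x s].
  by move: em sq; rewrite emm big_nil => /eqp_size ->; rewrite size_poly1.
exists x; first by apply: (mem_mask (m := m)); rewrite emm mem_head.
by rewrite (eqp_root em) emm big_cons rootM root_XsubC eqxx.
Qed.

Section QuarticSplittingField.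

Variables (L : splittingFieldType rat) (R : realType) (t : R).
Hypothesis root_t : root (map_poly ratr quartic) t.
Let p := map_poly (in_alg L) quartic.
Hypothesis splitL : splittingFieldFor 1%AS p {:L}.

Let two0 : (2 : L) != 0.
Proof. by rewrite -[2](rmorph_nat (in_alg L)) fmorph_eq0. Qed.

(* A square root [g(a)] of -1 would make the quartic, which has the real root
   [t], divide [g ^+ 2 + 1], which has none. *)
Lemma quartic_root_neg1_notin_adjoin (a b : L) :
  root p a -> b \in <<1; a>>%VS -> b ^+ 2 != -1.
Proof.
move=> pa /Fadjoin1_polyP[g ->]; apply/eqP => g2.
have : quartic %| g ^+ 2 + 1.
  rewrite -(dvdp_map (in_alg L)).
  rewrite -(eqp_dvdl _ (irreducible_minPoly _ _ _ _ irreducible_quartic pa)).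
  apply: minPoly_dvdp; first by apply/polyOver1P; exists (g ^+ 2 + 1).
  by rewrite /root rmorphD rmorphXn rmorph1 /= !hornerE g2 addNr.
rewrite -(dvdp_map (ratr : rat -> R)) => /root_dvdp/(_ root_t).
rewrite /root rmorphD rmorphXn rmorph1 /= !hornerE => /eqP e.
by have := sqr_ge0 (map_poly (ratr : rat -> R) g).[t]; lra.
Qed.

(** The quartic is even, so it factors as 4 (X - a) (X + a) (X^2 + 1 + a^2), with roots a, -a, b,
    -b. *)
Lemma quartic_roots : exists a b : L,
  [/\ root p a, b ^+ 2 = - 1 - a ^+ 2, (2 * (a * b)) ^+ 2 = -1
    & <<<<1; a>>; b>>%VS = fullv].
Proof.
have [rs eqp gen] := splitL.
have [|a _ pa] := splits_root _ _ _ _ eqp (dvdpp p).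
  by rewrite size_map_poly size_quartic.
have pa0 : 4 * a ^+ 4 + 4 * a ^+ 2 - 1 = 0.
  by rewrite -(horner_quartic _ (in_alg L)); apply/eqP.
pose q : {poly L} := 'X^2 + (1 + a ^+ 2)%:P.
have pE : p = (4%:P * ('X - a%:P) * ('X + a%:P)) * q.
  rewrite /p /quartic /q rmorphB rmorphD /= !map_polyZ rmorph1 !map_polyXn /=
    !rmorph_nat.
  rewrite -!mul_polyC !(rmorphD, rmorphXn, rmorph1) /=.
  (* Subtracting this zero constant turns the factorization into a ring identity. *)
  have e : 4%:P * a%:P ^+ 4 + 4%:P * a%:P ^+ 2 - 1 = 0 :> {poly L}.
    by rewrite -!rmorphXn -!rmorphM -rmorphD -rmorphB /= pa0.
  have -> : 4%:A = 4 :> L by exact: (rmorph_nat (in_alg L) 4).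
  rewrite -[LHS]subr0 -e !polyC_natr; ring.
have qE x : q.[x] = x ^+ 2 + (1 + a ^+ 2) by rewrite !hornerD hornerXn hornerC.
have [||b _ qb] := splits_root _ _ q _ eqp.
- by rewrite pE dvdp_mull.
- by rewrite size_polyDl size_polyXn // size_polyC; case: (_ == _).
have b2 : b ^+ 2 = -1 - a ^+ 2.
  by move: qb; rewrite /root qE => /eqP e; rewrite -[LHS]addr0 -oppr0 -e; ring.
exists a, b; split=> //.
  have -> : (2 * (a * b)) ^+ 2 = 4 * a ^+ 2 * b ^+ 2 by ring.
  by rewrite b2 -[RHS]addr0 -oppr0 -pa0; ring.
apply/eqP; rewrite eqEsubv subvf /= -gen; apply/Fadjoin_seqP; split.
  by rewrite sub1v.
move=> r rrs; have pr : root p r.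
  by rewrite (eqp_root eqp) root_prod_XsubC.
have aE : a \in <<<<1; a>>; b>>%VS.
  by rewrite (subvP (subv_adjoin _ _)) ?memv_adjoin.
have bE : b \in <<<<1; a>>; b>>%VS by rewrite memv_adjoin.
move: pr; rewrite pE !rootM root_XsubC rootC -[X in 'X + X]opprK -polyCN.
rewrite root_XsubC -!orbA => /or4P[|/eqP->|/eqP->|] //.
- by rewrite (negPf (_ : (4 : L) != 0)) // (natrM _ 2 2) mulf_neq0.
- by rewrite rpredN.
have -> : root q r = ((r - b) * (r + b) == 0).
  by rewrite -subr_sqr b2 /root qE; congr (_ == _); ring.
rewrite mulf_eq0 => /orP[].
  by rewrite subr_eq0 => /eqP->.
by rewrite addr_eq0 => /eqP->; rewrite rpredN.
Qed.

Lemma quartic_galois_dihedral :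
  ('Gal({:L} / 1%AS) \isog [set: dihedral_gtype 8]%G)%g.
Proof.
have [a [b [pa b2 ab2 genab]]] := quartic_roots.
have aE : a \in <<1; a>>%VS by rewrite memv_adjoin.
have nba : b \notin <<1; a>>%VS.
  apply/negP => bE.
  have abE : 2 * (a * b) \in <<1; a>>%VS by rewrite !rpredM // rpred_nat.
  have := quartic_root_neg1_notin_adjoin a (2 * (a * b)) pa abE.
  by rewrite ab2 eqxx.
have pa0 : 4 * a ^+ 4 + 4 * a ^+ 2 - 1 = 0.
  by rewrite -(horner_quartic _ (in_alg L)); apply/eqP.
have deg_a := irreducible_minPoly _ _ _ _ irreducible_quartic pa.
have minb : minPoly <<1; a>> b = 'X^2 - (b ^+ 2)%:P.
  apply/eqP; rewrite -eqp_monic ?monic_minPoly ?monicXnsubC //.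
  have dvdb : minPoly <<1; a>> b %| 'X^2 - (b ^+ 2)%:P.
    apply: minPoly_dvdp; last by rewrite /root !hornerE subrr.
    rewrite rpredB ?rpredX ?polyOverX // polyOverC b2.
    by rewrite rpredB ?rpredN ?rpred1 ?rpredX.
  rewrite -(dvdp_size_eqp dvdb) size_XnsubC // eqn_leq.
  have /dvdp_leq := dvdb; rewrite -size_poly_eq0 size_XnsubC // => -> //=.
  rewrite size_minPoly ltnS.
  have := adjoin_deg_eq1 <<1; a>> b; rewrite (negPf nba).
  have : (adjoin_degree <<1; a>> b != 0)%N by [].
  by case: adjoin_degree => [|[]].
have minb_neg : root (minPoly <<1; a>> b) (- b).
  by rewrite minb /root !hornerE sqrrN subrr.
(* Being conjugate to [a] over the rationals, [b] is the image of [a] under some automorphism. *)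
have mina_b : root (minPoly 1 a) b.
  rewrite (eqp_root deg_a) /root horner_quartic.
  have -> : b ^+ 4 = (b ^+ 2) ^+ 2 by rewrite -exprM.
  by rewrite b2 -[X in _ == X]pa0; apply/eqP; ring.
have nor (K : {subfield L}) : normalField K {:L} by apply: normalFieldf.
have gal1 : galois 1 {:L}.
  rewrite /galois sub1v nor andbT; apply/separableP => x _.
  apply: pcharf0_separable; apply/pcharf0P => n.
  by rewrite -(rmorph_nat (in_alg L)) fmorph_eq0 pnatr_eq0.
have a0 : a != 0.
  apply: contra_eq_neq pa0 => ->.
  by rewrite !expr0n !mulr0 !add0r oppr_eq0 oner_neq0.
have nN (z : L) : z != 0 -> (- z == z) = false.
  move=> z0; rewrite -subr_eq0 -opprD oppr_eq0 -mulr2n -mulr_natl mulf_eq0.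
  by rewrite (negPf two0) (negPf z0).
(* The fixed field of [g * h^-1] contains the generators [a] and [b], hence all of [L]. *)
have galE (g h : gal_of {:L}) : g a = h a -> g b = h b -> g = h.
  move=> ea eb; have fix_gh z : g z = h z -> z \in fixedSpace (g * h^-1)%g.
    move=> e; apply/fixedSpaceP.
    by rewrite galM ?memvf // e -galM ?memvf // mulgV gal_id.
  have /subvP fixL : ({:L} <= fixedSpace (g * h^-1)%g)%VS.
    rewrite -{1}genab; apply/FadjoinP; rewrite fix_gh //; split=> //.
    by apply/FadjoinP; rewrite fix_gh // sub1v.
  apply/eqP/gal_eqP => z _; have /fixedSpaceP := fixL z (memvf z).
  rewrite galM ?memvf // => e.
  by rewrite -[in RHS]e -galM ?memvf // mulVg gal_id.
have [s sG sa] := normalField_root_minPoly (sub1v _) (nor _) (memvf a) mina_b.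
have [u uG ub] := normalField_root_minPoly (subvf _) (nor _) (memvf b) minb_neg.
have ua : u a = a by apply: fixed_gal uG _ => //; rewrite subvf.
have uG1 : u \in 'Gal({:L} / 1%AS)%g by apply: fintype.subsetP uG; rewrite galS ?sub1v.
(* The quarter turn [a -> b -> -a -> -b]; composing with the reflection [u]
   fixes the sign of [s b]. *)
have [x [xG xa xb]] :
    exists x, [/\ x \in 'Gal({:L} / 1%AS)%g, x a = b & x b = - a].
  have : s b ^+ 2 = a ^+ 2.
    by rewrite -rmorphXn b2 /= rmorphB rmorphN rmorph1 rmorphXn /= sa b2; ring.
  move=> /eqP; rewrite eqf_sqr => /orP[]/eqP sb; last by exists s.
  exists (u * s)%g; rewrite groupM //; split=> //; rewrite galM ?memvf //.
    by rewrite ua.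
  by rewrite ub rmorphN /= sb.
(* The order is the degree of [L], computed along the tower of degrees 4 and 2. *)
have oG : #|'Gal({:L} / 1%AS)%g| = 4.*2.
  rewrite -galois_dim // dimv1 divn1 -[LHS]/(\dim {:L}%VS).
  rewrite -genab !dim_Fadjoin dimv1 muln1.
  have -> : adjoin_degree <<1; a>> b = 2.
    by apply: succn_inj; rewrite -size_minPoly minb size_XnsubC.
  have -> // : adjoin_degree 1 a = 4.
  apply: succn_inj; rewrite -size_minPoly (eqp_size deg_a).
  by rewrite size_map_poly size_quartic.
have x2a : (x ^+ 2)%g a = - a by rewrite expgS expg1 galM ?memvf // xa.
have x2b : (x ^+ 2)%g b = - b by rewrite expgS expg1 galM ?memvf // xb rmorphN /= xa.
have x2 : (x ^+ 2 != 1)%g.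
  by apply/eqP => e; have := nN a a0; rewrite -x2a e gal_id eqxx.
have xu : (x ^ u = x^-1)%g.
  (* The relation becomes x u x = u, which is checked on [a] and [b]. *)
  apply: (mulgI u); rewrite -conjgC; apply: (mulIg x); rewrite mulgKV.
  apply: galE; rewrite !galM ?memvf //.
    by rewrite xa ub rmorphN /= xb opprK ua.
  by rewrite xb rmorphN /= ua rmorphN /= xa ub.
apply: (isog_dihedral _ _ x u 4) => //.
(* The order of [x] divides 4 but not 2. *)
- have : (#[x] %| 4)%N%g.
    rewrite order_dvdn; apply/eqP/galE; rewrite (expgM x 2 2) expgS expg1.
      by rewrite galM ?memvf // x2a rmorphN /= x2a opprK gal_id.
    by rewrite galM ?memvf // x2b rmorphN /= x2b opprK gal_id.
  move: x2; rewrite -order_dvdn => + d4; have := dvdn_leq (isT : (0 < 4)%N) d4.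
  by case: #[x]%g d4 => [|[|[|[|[|]]]]].
- by apply: galE; rewrite expgS expg1 galM ?memvf // gal_id ?ua // ub rmorphN /= ub opprK.
(* A power of [x] commutes with [x], so the conjugation relation would read x = x^-1. *)
- apply: contra x2 => /cycleP[k ek]; move: xu.
  rewrite ek conjgE -expgS expgSr mulKg => e.
  by rewrite expgS expg1 {1}e mulVg.
Qed.
End QuarticSplittingField.

(** * The tangency point as an algebraic number *)

Lemma root_quartic_tangency_point (R : realType) :
  root (map_poly (ratr : rat -> R) quartic) tangency_point.
Proof.
have mm := chord_slope_sqr R.
rewrite /root (horner_quartic _ (ratr : {rmorphism rat -> R})) (exprM _ 2 2).
(* Substituting m / 2 for the square leaves m^2 + 2 m - 1. *)
by rewrite tangency_point_sqr; apply/eqP; lra.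
Qed.

Lemma tangency_point_by_radicals (R : realType) :
  expressible_by_radicals ((tangency_point : R)%:C)%C.
Proof.
have rad_nat n : expressible_by_radicals (n%:R : R[i]).
  by rewrite -(ratr_nat R[i]); apply: Radical_rat.
(* Two square root extractions suffice: this one for the point itself, a later one for sqrt 2. *)
apply: (@Radical_root _ 2) => //.
rewrite -rmorphXn /= tangency_point_sqr rmorphM /= fmorphV rmorph_nat rmorphB rmorph1 /=.
apply: Radical_mul; last exact/Radical_inv/rad_nat.
apply: Radical_add; last exact/Radical_opp/(rad_nat 1).
apply: (@Radical_root _ 2) => //.
by rewrite -rmorphXn /= sqr_sqrtr // rmorph_nat.
Qed.

Theorem mainTheorem4 (R : realType) :
  (exists! h : {poly R}, best_linear_approx h) /\
  forall h : {poly R}, best_linear_approx h ->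
    (exists! t1 : R, interior_critical_point h t1) /\
    forall t1 : R, interior_critical_point h t1 ->
      interior_alternation_point h t1 /\
      t1 = Num.sqrt ((Num.sqrt 2 - 1) / 2) /\
      root (map_poly ratr quartic) t1 /\
      irreducible_poly quartic /\
      galois_group_isog quartic [set: dihedral_gtype 8]%G /\
      expressible_by_radicals (t1%:C)%C.
Proof.
split.
  exists best_line; split=> [|g]; first exact/best_linear_approxP.
  by move/best_linear_approxP.
move=> _ /best_linear_approxP ->; split.
  exists tangency_point; split=> [|t]; first exact/best_line_critical.
  by move/best_line_critical.
move=> _ /best_line_critical ->; split; first exact: best_line_alternation.
split=> //; split; first exact: root_quartic_tangency_point.
split; first exact: irreducible_quartic.
split; last exact: tangency_point_by_radicals.
split=> [|L splitL].
  by apply: splitting_field_exists; rewrite -size_poly_eq0 size_quartic.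
exact: quartic_galois_dihedral (root_quartic_tangency_point R) splitL.
Qed.
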